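(* Let $\mathbb{K}$ be a field, $R=\mathbb{K}[x_1,\dots,x_d]$, and let $I$ be a (nonzero proper) monomial ideal of $R$. Let $e=\mathrm{lcm}\{v(I)\mid v\in\mathcal{RV}(I)\}$. Then $\bigcup_{n\in\mathbb{N}}\mathrm{Ass}(R/I^{\frac{n}{e}})$ is finite.
   Context: Rational powers: for an ideal $I$ of a commutative ring $A$ and $\frac{a}{b}\in\mathbb{Q}_+$ with $a,b$ positive integers, $I^{\frac{a}{b}}=\{x\in A \mid x^b\in\overline{I^a}\}$, where $\overline{\phantom{I}}$ denotes integral closure of ideals; this is an ideal depending only on the rational number $\frac{a}{b}$ (and $I^0=A$). Rees valuations: for a nonzero proper ideal $I$ of $R$ and a discrete rank one valuation $v$ on the fraction field of $R$ that is nonnegative on $R$, put $v(I)=\min\{v(x)\mid 0\neq x\in I\}$. $\mathcal{RV}(I)$ denotes the set of Rees valuations of $I$, i.e. the unique (up to equivalence) minimal finite set of such valuations, normalized (value group $\mathbb{Z}$), for which, for all $n$: $x\in\overline{I^n}$ if and only if $v(x)\geqslant n\,v(I)$ for all $v\in\mathcal{RV}(I)$. *)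

(* Defs.v *)
From HB Require Import structures.
From mathcomp Require Import all_boot all_order all_algebra.
From mathcomp Require Import boolp classical_sets functions cardinality fsbigop.
From mathcomp Require Import mpoly.

Set Implicit Arguments.
Unset Strict Implicit.
Unset Printing Implicit Defensive.

Import Order.TTheory GRing.Theory Num.Theory.
Local Open Scope classical_set_scope.
Local Open Scope ring_scope.

Definition ideal (A : comNzRingType) (J : set A) : Prop :=
  [/\ J 0,
      forall x y, J x -> J y -> J (x + y)
    & forall a x, J x -> J (a * x)].

Definition prime_ideal (A : comNzRingType) (P : set A) : Prop :=
  [/\ ideal P,
      P <> setT
    & forall x y, P (x * y) -> P x \/ P y].

Definition ideal_span (A : comNzRingType) (S : set A) : set A :=
  smallest (@ideal A) S.

Definition ideal_mul (A : comNzRingType) (J1 J2 : set A) : set A :=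
  ideal_span [set x * y | x in J1 & y in J2].

Definition ideal_pow (A : comNzRingType) (J : set A) (n : nat) : set A :=
  iter n (ideal_mul J) setT.

Definition integral_closure (A : comNzRingType) (J : set A) : set A :=
  [set x | exists (k : nat) (c : nat -> A),
    [/\ (0 < k)%N,
        forall i, (1 <= i <= k)%N -> ideal_pow J i (c i)
      & x ^+ k + \sum_(1 <= i < k.+1) c i * x ^+ (k - i) = 0]].

(* [rational_pow J a b] is J^(a/b) for b > 0.  It depends on a and b only      *)
(* through the rational number a/b.  For a = 0 it is the whole ring.          *)
Definition rational_pow (A : comNzRingType) (J : set A) (a b : nat) : set A :=
  [set x | integral_closure (ideal_pow J a) (x ^+ b)].

(* [Ass J] is Ass(A/J): the annihilator of the class of x in A/J is the colon *)
(* ideal (J : x).                                                             *)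
Definition Ass (A : comNzRingType) (J : set A) : set (set A) :=
  [set P | prime_ideal P /\ exists x, P = [set r | J (r * x)]].

(* A normalized discrete rank one valuation on F, with value group int.  The  *)
(* value +oo at 0 is not represented: [v 0] is set to 0, so that valuations   *)
(* agreeing on nonzero elements are equal, and is never used otherwise.       *)
Definition discrete_valuation (F : fieldType) (v : F -> int) : Prop :=
  [/\ v 0 = 0,
      forall x y, x != 0 -> y != 0 -> v (x * y) = v x + v y,
      forall x y, x != 0 -> y != 0 -> x + y != 0 ->
        Num.min (v x) (v y) <= v (x + y)
    & forall m : int, exists2 x, x != 0 & v x = m].

Definition nonneg_on (R : idomainType) (v : {fraction R} -> int) : Prop :=
  forall x : R, x != 0 -> 0 <= v (tofrac x).

(* The minimum of v on I \ {0}; it exists, and the default 0 is not used, when *)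
(* I is nonzero and v is nonnegative on R.                                    *)
Definition val_ideal (R : idomainType) (v : {fraction R} -> int) (I : set R)
    : int :=
  xget 0 [set m | (exists2 x, I x /\ x != 0 & v (tofrac x) = m) /\
                  (forall x, I x -> x != 0 -> m <= v (tofrac x))].

Definition computes_closures (R : idomainType) (I : set R)
    (S : set ({fraction R} -> int)) : Prop :=
  forall (n : nat) (x : R), x != 0 ->
    integral_closure (ideal_pow I n) x <->
    (forall v, S v -> n%:Z * val_ideal v I <= v (tofrac x)).

(* RV is the set of Rees valuations of I: minimality is with respect to       *)
(* inclusion.  Over a Noetherian domain such an RV exists and is unique for I *)
(* nonzero and proper, and all its members satisfy v(I) > 0.                  *)
Definition rees_valuations (R : idomainType) (I : set R)
    (RV : set ({fraction R} -> int)) : Prop :=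
  [/\ finite_set RV,
      forall v, RV v -> discrete_valuation v /\ nonneg_on v,
      computes_closures I RV
    & forall T, T `<=` RV -> computes_closures I T -> T = RV].

Definition lcm_val_ideal (R : idomainType) (I : set R)
    (RV : set ({fraction R} -> int)) : nat :=
  \big[lcmn/1%N]_(v \in RV) `|val_ideal v I|%N.

Definition monomial_ideal (K : fieldType) (d : nat) (I : set {mpoly K[d]})
    : Prop :=
  exists G : set 'X_{1..d}, I = ideal_span [set 'X_[m] | m in G].

(* Main.v *)
Require Import Defs.
From mathcomp Require Import all_boot all_order all_algebra.
From mathcomp Require Import boolp classical_sets functions cardinality fsbigop.
From mathcomp Require Import mpoly.
From mathcomp Require Import zify.

(** The associated primes of all the rational powers of I are among the
    centers {r | v(r) > 0} of the Rees valuations v of I, and there are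
    finitely many Rees valuations.

    Indeed, for b > 0, a nonzero y lies in I^(a/b) exactly when
    b v(y) >= a v(I) for every Rees valuation v, because v(y^b) = b v(y).
    Hence a prime P = (I^(a/b) : x) is the finite intersection, over the Rees
    valuations v, of the ideals {r | b v(r x) >= a v(I)}.  A prime which is a
    finite intersection of ideals is one of them ([prime_ideal_bigcap]), so P
    is the ideal given by a single v ([Ass_rational_pow_center]).  As P is
    proper, 1 fails the inequality for v, so that all the elements of P have
    positive value; conversely a large power of an element of positive value
    satisfies the inequality, hence lies in P, and P is prime.

    The argument is a general one: over any integral domain, it applies to
    every finite set of nonnegative valuations that determines the integral
    closures of the powers of I. *)

Import Order.TTheory GRing.Theory Num.Theory.

Local Open Scope classical_set_scope.
Local Open Scope ring_scope.

(** The zero element has to be added by hand, since a valuation takes the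
    value 0, in place of +oo, at 0. *)
Definition center {R : idomainType} (v : {fraction R} -> int) : set R :=
  [set r | r = 0 \/ 0 < v (tofrac r)].

Lemma prime_ideal_not1 {A : comNzRingType} {P : set A} :
  prime_ideal P -> ~ P 1.
Proof.
case=> -[_ _ mulP] properP _ P1; apply: properP.
by apply/seteqP; split=> // r _; rewrite -[r]mulr1; apply: mulP.
Qed.

Lemma prime_ideal_exp {A : comNzRingType} {P : set A} (primeP : prime_ideal P)
    (x : A) (n : nat) : P (x ^+ n) -> P x.
Proof.
have P1 := prime_ideal_not1 primeP; have [_ _ mulP] := primeP.
by elim: n => [//|n IHn]; rewrite exprS => /mulP [].
Qed.

(** Otherwise a product of elements, one in each member of the family and
    outside P, would lie in all the members and outside P. *)
Lemma prime_ideal_bigcap {A : comNzRingType} {P : set A} {T : eqType}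
    {S : set T} {Q : T -> set A} (primeP : prime_ideal P)
    (finS : finite_set S) (mulQ : forall t a r, S t -> Q t r -> Q t (a * r))
    (subP : \bigcap_(t in S) Q t `<=` P) :
  exists2 t, S t & Q t `<=` P.
Proof.
apply: contrapT => noQ.
have outP t : S t -> exists2 r, Q t r & ~ P r.
  move=> St; apply: contrapT => h; apply: noQ; exists t => // r Qr.
  by apply: contrapT => Pr; apply: h; exists r.
have /finite_seqP [s Ss] := finS.
suff [r Pr Qr] : exists2 r, ~ P r & forall t, t \in s -> Q t r.
  apply: Pr; apply: subP => t St; apply: Qr.
  by have : [set` s] t by rewrite -Ss.
have {Ss} : forall t, t \in s -> S t by move=> t ts; rewrite Ss.
elim: s => [_|t s IHs sS]; first by exists 1 => //; apply: prime_ideal_not1.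
have [u us|r Pr Qr] := IHs; first by apply: sS; rewrite inE us orbT.
have St : S t by apply: sS; rewrite inE eqxx.
have [q Qq Pq] := outP t St.
exists (q * r) => [|u].
  by case: primeP => _ _ primeP /primeP [].
rewrite inE => /orP [/eqP ->|us]; first by rewrite mulrC; apply: mulQ.
by apply: mulQ; [apply: sS; rewrite inE us orbT | apply: Qr].
Qed.

Lemma valuationX {F : fieldType} {v : F -> int} (dv : discrete_valuation v)
    (x : F) (n : nat) : x != 0 -> v (x ^+ n) = n%:Z * v x.
Proof.
case: dv => _ vM _ _ x0.
elim: n => [|n IHn].
  have := vM 1 1 (oner_neq0 _) (oner_neq0 _).
  by rewrite expr0 mulr1; lia.
by rewrite exprS vM ?expf_neq0 // IHn; lia.
Qed.

(** The valuations turn an associated prime P into a finite intersection of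
    the ideals Q v of the proof.  Hence P contains, and so equals, some Q v,
    and a proper Q v has the center of v as its radical. *)
Lemma Ass_rational_pow_center {R : idomainType} {I : set R}
    {S : set ({fraction R} -> int)} (finS : finite_set S)
    (valS : forall v, S v -> discrete_valuation v /\ nonneg_on v)
    (closS : computes_closures I S) (a b : nat) :
  Ass (rational_pow I a b) `<=` center @` S.
Proof.
move=> P [primeP [x defP]].
have [[P0 _ _] _ _] := primeP; have P1 := prime_ideal_not1 primeP.
(* Multiplication by 0 is a constant map, so P would be empty or full. *)
have x0 : x != 0.
  apply/eqP => x0; apply: P1; move: P0.
  by rewrite defP x0 /= !mulr0.
(* Likewise, membership in the power of exponent a/0 is constant. *)
have b0 : (0 < b)%N.
  case: b defP => // defP; exfalso; apply: P1; move: P0.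
  by rewrite defP /rational_pow /= !expr0.
have PE r : r != 0 -> P r <-> forall v, S v ->
    a%:Z * val_ideal v I <= b%:Z * (v (tofrac r) + v (tofrac x)).
  move=> r0; rewrite defP /rational_pow /=.
  have rx0 : r * x != 0 by rewrite mulf_neq0.
  have vE v : S v ->
      v (tofrac ((r * x) ^+ b)) = b%:Z * (v (tofrac r) + v (tofrac x)).
    move=> /valS [dv _]; rewrite tofracXn (valuationX dv) ?tofrac_eq0 //.
    by case: dv => _ vM _ _; rewrite tofracM vM ?tofrac_eq0.
  have -> := closS a _ (expf_neq0 b rx0).
  by split=> h v Sv; have := h v Sv; rewrite vE.
pose Q (v : {fraction R} -> int) : set R := [set r | r = 0 \/
  a%:Z * val_ideal v I <= b%:Z * (v (tofrac r) + v (tofrac x))].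
have [|r Qr|v Sv QP] := @prime_ideal_bigcap _ P _ S Q primeP finS.
- move=> v c r Sv [->|Qr]; first by left; rewrite mulr0.
  have [->|c0] := eqVneq c 0; first by left; rewrite mul0r.
  have [->|r0] := eqVneq r 0; first by left; rewrite mulr0.
  right; have [[_ vM _ _] v_ge0] := valS v Sv.
  rewrite tofracM vM ?tofrac_eq0 //; apply: (le_trans Qr).
  by rewrite ler_wpM2l // lerD2r lerDr v_ge0.
- have [->//|r0] := eqVneq r 0; apply/PE => // v Sv.
  by case: (Qr v Sv) => // r00; rewrite r00 eqxx in r0.
have [dv v_ge0] := valS v Sv.
have v1 : v (tofrac 1) = 0.
  by rewrite -[1](expr0 x) tofracXn (valuationX dv) ?tofrac_eq0 ?mul0r.
exists v => //; apply/seteqP; split=> r.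
  case=> [->//|vr].
  have [->//|r0] := eqVneq r 0.
  (* As b and v(r) are at least 1, the exponent N only has to exceed the
     deficit of 1 in the inequality defining Q v. *)
  pose N := `|(a%:Z * val_ideal v I - b%:Z * v (tofrac x))%R|%N.
  apply: (prime_ideal_exp primeP r N); apply: QP; right.
  rewrite tofracXn (valuationX dv) ?tofrac_eq0 // mulrDr.
  have : N%:Z <= b%:Z * (N%:Z * v (tofrac r)).
    have vr1 : 1 <= v (tofrac r) by lia.
    have b1 : 1 <= b%:Z by lia.
    by rewrite mulrCA ler_peMr // mulr_ege1.
  rewrite /N; lia.
have [->|r0] := eqVneq r 0; first by left.
move=> /(PE r r0) /(_ v Sv) Qr; right; rewrite ltNge; apply/negP => vr.
apply: P1; apply: QP; right; rewrite v1.
by apply: (le_trans Qr); rewrite ler_wpM2l // lerD2r.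
Qed.

Theorem corollary5p5 (K : fieldType) (d : nat) (I : set {mpoly K[d]})
    (RV : set ({fraction {mpoly K[d]}} -> int))
    (monI : monomial_ideal I) (nzI : I <> [set 0]) (prI : I <> setT)
    (RVI : rees_valuations I RV) :
  let e := lcm_val_ideal I RV in
  finite_set (\bigcup_(n in [set: nat]) Ass (rational_pow I n e)).
Proof.
move=> e; have [finRV valRV closRV _] := RVI.
apply: (sub_finite_set _ (finite_image center finRV)).
by apply: bigcup_sub => n _; apply: Ass_rational_pow_center.
Qed.
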